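(* Let $R$ be a commutative Artinian local ring with unity, with maximal ideal $\mathcal{M}$. Then the prime ideal sum graph $\mathrm{PIS}(R)$ is the complement of a line graph if and only if one of the following holds: (i) $R$ is a principal ideal ring; (ii) $\mathcal{M} = \langle x, y \rangle$ for some $x, y \in R$ such that $x^2 = y^2 = xy = 0$.
   Context: The prime ideal sum graph $\mathrm{PIS}(R)$ of a commutative ring $R$ with unity is the simple undirected graph whose vertex set is the set of all nonzero proper ideals of $R$, where two distinct vertices $I, J$ are adjacent if and only if $I + J$ is a prime ideal of $R$. A local ring is a ring with a unique maximal ideal; fields are included, with maximal ideal $\langle 0\rangle$. $\langle x_1,\dots,x_n\rangle$ denotes the ideal generated by $x_1,\dots,x_n$. The line graph $L(\Gamma)$ of a (simple) graph $\Gamma$ has as vertices the edges of $\Gamma$, two distinct vertices being adjacent if the corresponding edges share an endpoint in $\Gamma$. The complement $\overline{\Gamma}$ of a graph $\Gamma$ has the same vertex set, with two distinct vertices adjacent if and only if they are not adjacent in $\Gamma$. A graph is ''the complement of a line graph'' if it is isomorphic to $\overline{L(\Gamma)}$ for some graph $\Gamma$. The graph with no vertices (which is $\mathrm{PIS}(R)$ when $R$ is a field) is regarded as the line graph of the null graph, and hence also as the complement of a line graph. *)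

(* Defs.v *)
From HB Require Import structures.
From mathcomp Require Import all_boot all_order all_algebra.
From mathcomp Require Import all_classical.

Set Implicit Arguments.
Unset Strict Implicit.
Unset Printing Implicit Defensive.

Import GRing.Theory.

Local Open Scope classical_set_scope.
Local Open Scope ring_scope.

(* Simple undirected graphs on an arbitrary, possibly empty or infinite,
   vertex type. *)
Record sgraph := SGraph {
  vertex :> Type;
  adj : vertex -> vertex -> Prop;
  adj_sym : forall u v, adj u v -> adj v u;
  adj_irr : forall v, ~ adj v v
}.

Definition sgraph_iso (G H : sgraph) : Prop :=
  exists2 f : G -> H, bijective f & forall u v, adj u v <-> adj (f u) (f v).

Definition edge_set (G : sgraph) : set (set G) :=
  [set e | exists u v : G, adj u v /\ e = [set u; v]].
Arguments edge_set : clear implicits.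

Definition line_adj (G : sgraph) (e f : edge_set G) : Prop :=
  e <> f /\ (val e `&` val f !=set0).

Lemma line_adj_sym (G : sgraph) (e f : edge_set G) :
  line_adj e f -> line_adj f e.
Proof. by move=> [/nesym nef]; rewrite setIC. Qed.

Lemma line_adj_irr (G : sgraph) (e : edge_set G) : ~ line_adj e e.
Proof. by case. Qed.

Definition line_graph (G : sgraph) : sgraph :=
  SGraph (@line_adj_sym G) (@line_adj_irr G).

Definition co_adj (G : sgraph) (u v : G) : Prop := u <> v /\ ~ adj u v.

Lemma co_adj_sym (G : sgraph) (u v : G) : co_adj u v -> co_adj v u.
Proof. by move=> [/nesym nuv nadj]; split=> // /adj_sym. Qed.

Lemma co_adj_irr (G : sgraph) (v : G) : ~ co_adj v v.
Proof. by case. Qed.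

Definition graph_complement (G : sgraph) : sgraph :=
  SGraph (@co_adj_sym G) (@co_adj_irr G).

Definition is_co_line_graph (H : sgraph) : Prop :=
  exists G : sgraph, sgraph_iso H (graph_complement (line_graph G)).

Section Ideals.
Variable R : comNzRingType.
Implicit Types I J M : set R.

(* The predicate [idealr_closed] of MathComp only holds of proper ideals; an
   arbitrary ideal is a submodule of the regular module. *)
Definition is_ideal I : Prop := submod_closed ([in I] : {pred R^o}).

Definition is_proper_ideal I : Prop := idealr_closed [in I].

Lemma is_proper_idealP I : is_proper_ideal I <-> is_ideal I /\ I <> setT.
Proof.
split=> [[I0 I1 IL]|[[I0 IL] IT]].
  by split=> // IT; move: I1; rewrite IT in_setT.
split=> //; apply/negP => I1; apply: IT; apply/seteqP; split=> // x _.
by have := IL x _ _ I1 I0; rewrite /= addr0 [_ *: _]mulr1 inE.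
Qed.

Definition is_prime_ideal I : Prop :=
  is_proper_ideal I /\ prime_idealr_closed [in I].

Definition is_maximal_ideal M : Prop :=
  is_proper_ideal M /\ forall J, is_proper_ideal J -> M `<=` J -> J = M.

Definition ideal_sum I J : set R := [set a + b | a in I & b in J].

Lemma ideal_sumC I J : ideal_sum I J = ideal_sum J I.
Proof.
by apply/seteqP; split=> _ /= [a Ia [b Jb <-]];
  exists b => //; exists a => //; rewrite addrC.
Qed.

Definition ideal_gen (A : set R) : set R := smallest is_ideal A.

Definition pis_vertices : set (set R) :=
  [set I | is_proper_ideal I /\ I <> [set 0]].

Definition pis_adj (I J : pis_vertices) : Prop :=
  I <> J /\ is_prime_ideal (ideal_sum (val I) (val J)).

Lemma pis_adj_sym (I J : pis_vertices) : pis_adj I J -> pis_adj J I.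
Proof. by move=> [/nesym nIJ]; rewrite ideal_sumC. Qed.

Lemma pis_adj_irr (I : pis_vertices) : ~ pis_adj I I.
Proof. by case. Qed.

End Ideals.
Arguments pis_vertices : clear implicits.

Definition PIS (R : comNzRingType) : sgraph :=
  SGraph (@pis_adj_sym R) (@pis_adj_irr R).

Definition artinian (R : comNzRingType) : Prop :=
  forall I : nat -> set R, (forall n, is_ideal (I n)) ->
    (forall n, I n.+1 `<=` I n) ->
    exists N, forall n, (N <= n)%N -> I n = I N.

Definition local_ring_with (R : comNzRingType) (M : set R) : Prop :=
  is_maximal_ideal M /\ forall N : set R, is_maximal_ideal N -> N = M.

Definition principal_ideal_ring (R : comNzRingType) : Prop :=
  forall I : set R, is_ideal I -> exists a : R, I = ideal_gen [set a].

(* Main.v *)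
(* M is the only prime ideal, so I and J are adjacent iff they are distinct and
   I + J = M.  If M is principal, I + J = M forces I = M or J = M, and if M is
   generated by two elements with M^2 = 0, any two distinct vertices have sum M;
   in both cases PIS(R) is complete multipartite.  If M is not principal, then
   by Nakayama and Zorn there is an ideal P containing M^2 such that M / P has
   dimension 2 over R / M.  If P is nonzero, P and three lines of M / P form a
   claw in the complement of PIS(R), so P = 0, and then M^2 = 0. *)

Require Import Defs.
From mathcomp Require Import all_boot all_order all_algebra.
From mathcomp Require Import all_classical.
From mathcomp Require Import ring.

Set Implicit Arguments.
Unset Strict Implicit.
Unset Printing Implicit Defensive.

Import GRing.Theory.

Local Open Scope classical_set_scope.
Local Open Scope ring_scope.

(** * Complements of line graphs: complete multipartite graphs and claws *)

Lemma inj_surj_bij (A B : Type) (f : A -> B) :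
  injective f -> (forall b, exists a, f a = b) -> bijective f.
Proof.
move=> fI /choice[g gK]; exists g => // a.
exact: fI.
Qed.

Section CompleteMultipartite.
Variables (H : sgraph) (C : Type) (c : H -> C).

(** Each colour in the image of [c] is the centre of a star whose leaves are the vertices of that
    colour; any other colour is an isolated point and gives no edge. *)
Definition star_adj (u v : H + C) : Prop :=
  match u, v with
  | inl a, inr d | inr d, inl a => c a = d
  | _, _ => False
  end.

Lemma star_adj_sym u v : star_adj u v -> star_adj v u.
Proof. by case: u v => [a|d] [b|e]. Qed.

Lemma star_adj_irr v : ~ star_adj v v.
Proof. by case: v => ? []. Qed.

Definition star_graph : sgraph := SGraph star_adj_sym star_adj_irr.

Lemma star_edge_subproof (a : H) :
  [set (inl a : H + C); inr (c a)] \in edge_set star_graph.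
Proof. by apply: mem_set; exists (inl a), (inr (c a)). Qed.

Definition star_edge (a : H) : edge_set star_graph :=
  SigSub (star_edge_subproof a).

Lemma star_edge_inj : injective star_edge.
Proof.
move=> a b /(congr1 val) /= eab.
by have : [set (inl b : H + C); inr (c b)] (inl a) by [rewrite -eab; left];
  case=> [[]|].
Qed.

(* The complement is a disjoint union of cliques, hence the line graph of a
   disjoint union of stars. *)
Lemma complete_multipartite_co_line :
  (forall u v : H, adj u v <-> c u <> c v) -> is_co_line_graph H.
Proof.
move=> adjE; exists star_graph; exists star_edge.
  apply: inj_surj_bij; first exact: star_edge_inj.
  move=> [e eP]; have [u [v [uv ee]]] := set_mem eP.
  case: u v uv ee => [a|d] [b|e'] //= ca ee; [exists a|exists b];
    by apply: val_inj; rewrite /= ee ca // setUC.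
move=> u v; rewrite adjE; split.
  move=> cuv; split; first by move/star_edge_inj => uv; apply: cuv; rewrite uv.
  move=> [_ [z [/=]]] [] -> [] // [] // uv; first by apply: cuv; rewrite uv.
move=> [fuv nl] cuv; apply: nl; split => //.
by exists (inr (c u)); split => /=; right; rewrite ?cuv.
Qed.

End CompleteMultipartite.

(* A line graph has no claw: of three edges meeting a given edge, two meet it
   at the same endpoint. *)
Lemma co_line_no_coclaw (H : sgraph) (c a1 a2 a3 : H) :
  is_co_line_graph H ->
  c <> a1 -> c <> a2 -> c <> a3 ->
  ~ adj c a1 -> ~ adj c a2 -> ~ adj c a3 ->
  adj a1 a2 -> adj a1 a3 -> adj a2 a3 -> False.
Proof.
move=> [G [f /bij_inj fI fE]].
have meet a : c <> a -> ~ adj c a -> val (f c) `&` val (f a) !=set0.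
  move=> ca nca; apply: contrapT => nm; apply: nca; apply/fE; split.
    by move/fI.
  by case.
have disj a b z : adj a b -> val (f a) z -> val (f b) z -> False.
  by move=> /fE[fab nl] za zb; apply: nl; split => //; exists z.
move=> /meet m1 /meet m2 /meet m3 /m1[z1 [c1 d1]] /m2[z2 [c2 d2]].
move=> /m3[z3 [c3 d3]] a12 a13 a23.
have [u [v [_ ec]]] := set_mem (valP (f c)).
(* Each of [z1], [z2], [z3] is [u] or [v]; in all eight cases two of them coincide, which
   contradicts [disj] for the corresponding pair. *)
by move: c1 c2 c3; rewrite ec => -[] /= e1 [] /= e2 [] /= e3; subst;
  [apply: disj a12 _ _|apply: disj a12 _ _|apply: disj a13 _ _|
   apply: disj a23 _ _|apply: disj a23 _ _|apply: disj a13 _ _|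
   apply: disj a12 _ _|apply: disj a12 _ _]; eassumption.
Qed.

(** * Ideals of a commutative ring as subsets *)

Section Ideals.
Variable R : comNzRingType.
Implicit Types (I J K P : set R) (a b r s x y : R).

Lemma is_idealP I :
  is_ideal I <-> I 0 /\ forall r a b, I a -> I b -> I (r * a + b).
Proof.
split=> [[I0 IL]|[I0 IL]]; split.
- by rewrite inE in I0.
- move=> r a b /mem_set Ia /mem_set Ib.
  exact: set_mem (IL r a b Ia Ib).
- by rewrite inE.
- by move=> r a b; rewrite !inE => Ia Ib; apply: IL.
Qed.

Lemma ideal0 I : is_ideal I -> I 0. Proof. by case/is_idealP. Qed.

Lemma idealM I r a : is_ideal I -> I a -> I (r * a).
Proof.
by case/is_idealP=> I0 IL Ia; rewrite -[_ * _]addr0; apply: IL.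
Qed.

Lemma idealD I a b : is_ideal I -> I a -> I b -> I (a + b).
Proof. by case/is_idealP=> I0 IL Ia Ib; rewrite -[a]mul1r; apply: IL. Qed.

Lemma idealB I a b : is_ideal I -> I a -> I b -> I (a - b).
Proof.
by move=> iI Ia Ib; apply: idealD => //; rewrite -mulN1r; apply: idealM.
Qed.

Lemma ideal_sum_ideal I J :
  is_ideal I -> is_ideal J -> is_ideal (ideal_sum I J).
Proof.
move=> iI iJ; apply/is_idealP; split.
  by exists 0; [exact: ideal0|exists 0; [exact: ideal0|rewrite addr0]].
move=> r _ _ [a Ia [b Jb <-]] [a' Ia' [b' Jb' <-]].
exists (r * a + a'); first by apply: idealD => //; apply: idealM.
exists (r * b + b'); first by apply: idealD => //; apply: idealM.
by ring.
Qed.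

Lemma sub_ideal_suml I J : is_ideal J -> I `<=` ideal_sum I J.
Proof.
by move=> iJ a Ia; exists a => //; exists 0; rewrite ?addr0 //; apply: ideal0.
Qed.

Lemma sub_ideal_sumr I J : is_ideal I -> J `<=` ideal_sum I J.
Proof. by move=> iI; rewrite ideal_sumC; apply: sub_ideal_suml. Qed.

Lemma ideal_sum_sub I J K :
  is_ideal K -> I `<=` K -> J `<=` K -> ideal_sum I J `<=` K.
Proof. by move=> iK IK JK _ [a /IK Ka [b /JK Kb <-]]; apply: idealD. Qed.

Definition multiples a : set R := [set r * a | r in setT].

Lemma multiplesP a r : multiples a (r * a).
Proof. by exists r. Qed.

Lemma multiples_self a : multiples a a.
Proof. by exists 1; rewrite ?mul1r. Qed.

Lemma multiples_ideal a : is_ideal (multiples a).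
Proof.
apply/is_idealP; split; first by exists 0; rewrite ?mul0r.
by move=> r _ _ [s _ <-] [t _ <-]; exists (r * s + t) => //; ring.
Qed.

Lemma multiples_sub a I : is_ideal I -> I a -> multiples a `<=` I.
Proof. by move=> iI Ia _ [r _ <-]; apply: idealM. Qed.

Lemma ideal_gen_ideal (A : set R) : is_ideal (ideal_gen A).
Proof.
apply/is_idealP; split; first by move=> I [iI _]; apply: ideal0.
move=> r a b ha hb I IA; have [iI _] := IA.
by apply: idealD => //; [apply: idealM => //; apply: ha|apply: hb].
Qed.

Lemma ideal_gen1 a : ideal_gen [set a] = multiples a.
Proof.
apply/seteqP; split.
  apply: smallest_sub; first exact: multiples_ideal.
  by move=> _ ->; apply: multiples_self.
by apply: multiples_sub; [exact: ideal_gen_ideal|apply: sub_gen_smallest].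
Qed.

Lemma ideal_gen2 a b :
  ideal_gen [set a; b] = ideal_sum (multiples a) (multiples b).
Proof.
have [ia ib] := (multiples_ideal a, multiples_ideal b).
apply/seteqP; split.
  apply: smallest_sub; first exact: ideal_sum_ideal.
  by move=> _ [] ->; [apply: sub_ideal_suml|apply: sub_ideal_sumr] => //;
    apply: multiples_self.
by apply: ideal_sum_sub; [exact: ideal_gen_ideal| |];
  apply: multiples_sub; [exact: ideal_gen_ideal| |exact: ideal_gen_ideal|];
  apply: sub_gen_smallest; [left|right].
Qed.

Lemma is_properP I : is_proper_ideal I <-> is_ideal I /\ ~ I 1.
Proof.
rewrite is_proper_idealP; split=> -[iI nT]; split=> //.
  move=> I1; apply: nT; apply/seteqP; split=> // a _.
  by rewrite -[a]mulr1; apply: idealM.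
by move=> IT; apply: nT; rewrite IT.
Qed.

Lemma is_primeP P : is_prime_ideal P <->
  [/\ is_ideal P, ~ P 1 & forall a b, P (a * b) -> P a \/ P b].
Proof.
split=> [[/is_properP[iP P1] PM]|[iP P1 PM]].
  split=> // a b /mem_set/PM/orP[] /set_mem; by [left|right].
split; first exact/is_properP.
move=> a b; rewrite inE => /PM[] /mem_set ->; by rewrite ?orbT.
Qed.

(** The union of a nonempty chain of ideals is an ideal. Taking [S] to be {1} yields maximal ideals;
    a larger [S] serves to keep two elements independent modulo [P]. *)
Lemma Zorn_ideal (S I : set R) : is_ideal I -> I `<=` ~` S ->
  exists P, [/\ is_ideal P, I `<=` P, P `<=` ~` S &
    forall J, is_ideal J -> P `<=` J -> J `<=` ~` S -> J = P].
Proof.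
move=> iI IS.
pose Q := [set J | J = set0 \/ [/\ is_ideal J, I `<=` J & J `<=` ~` S]].
have QI : Q I by right; split.
have [F FQ totF|P [QP maxP]] := @Zorn_bigcup _ Q.
  have [[J0 [FJ0 J0n]]|noJ] := pselect (exists J, F J /\ J <> set0); last first.
    left; apply/seteqP; split=> // z [J FJ Jz]; apply: noJ.
    by exists J; split=> // J0; rewrite J0 in Jz.
  have good J : F J -> J !=set0 -> [/\ is_ideal J, I `<=` J & J `<=` ~` S].
    by move=> /FQ[-> [] //|].
  have {J0n} J0n : J0 !=set0 by apply/set0P/eqP.
  have [iJ0 IJ0 _] := good _ FJ0 J0n.
  right; split.
  - apply/is_idealP; split; first by exists J0 => //; apply: ideal0.
    move=> r a b [J FJ Ja] [K FK Kb].
    have [iJ _ _] := good _ FJ (ex_intro _ _ Ja).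
    have [iK _ _] := good _ FK (ex_intro _ _ Kb).
    have [/(_ _ Ja) Ka|/(_ _ Kb) Jb] := totF _ _ FJ FK.
      by exists K => //; apply: idealD => //; apply: idealM.
    by exists J => //; apply: idealD => //; apply: idealM.
  - by move=> a /IJ0; exists J0.
  - by move=> a [J FJ Ja]; have [_ _] := good _ FJ (ex_intro _ _ Ja); apply.
case: QP maxP => [->|[iP IP PS]] maxP.
  by case: (maxP I _ QI); split=> // /(_ 0 (ideal0 iI)).
exists P; split=> // J iJ PJ JS; apply: contrapT => JP.
apply: (maxP J); last by right; split=> //; apply: subset_trans PJ.
by split=> // JsP; apply: JP; apply/seteqP.
Qed.

End Ideals.

(** * Artinian local rings: units, nilpotents and the only prime ideal *)

Section ArtinianLocal.
Variables (R : comNzRingType) (M : set R).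
Hypotheses (artR : artinian R) (locM : local_ring_with M).
Implicit Types (I J P : set R) (a b m p r s w x y : R).

Lemma max_is_ideal : is_ideal M.
Proof. by have [[/is_properP[]]] := locM. Qed.

Lemma max_not1 : ~ M 1.
Proof. by have [[/is_properP[]]] := locM. Qed.

(** Zorn's lemma puts [I] inside a maximal ideal, which is [M] by uniqueness. *)
Lemma proper_sub_max I : is_ideal I -> ~ I 1 -> I `<=` M.
Proof.
move=> iI I1.
have IS : I `<=` ~` [set 1] by move=> a Ia a1; apply: I1; rewrite -a1.
have [P [iP IP PS maxP]] := Zorn_ideal iI IS.
suff <- : P = M by [].
have [_ uniqM] := locM; apply: uniqM; split.
  by apply/is_properP; split=> // /PS; apply.
move=> J /is_properP[iJ J1] PJ; apply: maxP => //.
by move=> a Ja a1; apply: J1; rewrite -a1.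
Qed.

Lemma unit_notin_max a : ~ M a -> exists b, b * a = 1.
Proof.
move=> nMa; have [[b _ ba]|n1] := pselect (multiples a 1); first by exists b.
case: nMa; apply: (proper_sub_max (multiples_ideal a) n1).
exact: multiples_self.
Qed.

(** Cyclic case of Nakayama: [1 - m] is a unit that kills [p]. *)
Lemma eq0_of_max_mul m p : M m -> p = m * p -> p = 0.
Proof.
move=> Mm pE; have [|b b1] := @unit_notin_max (1 - m).
  move=> M1m; apply: max_not1; rewrite -(subrK m 1).
  by apply: idealD => //; exact: max_is_ideal.
by rewrite -[p]mul1r -b1 -mulrA mulrBl mul1r -pE subrr mulr0.
Qed.

Lemma multiples_stable (p : nat -> R) :
  (forall n, multiples (p n) (p n.+1)) ->
  exists n r, p n = r * p n.+1.
Proof.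
move=> pS; have [|n|N NE] := @artR (fun n => multiples (p n)).
- by move=> n; apply: multiples_ideal.
- by apply: multiples_sub (pS n); apply: multiples_ideal.
have : multiples (p N.+1) (p N) by rewrite NE //; apply: multiples_self.
by move=> [r _ rE]; exists N, r.
Qed.

(** The chain of ideals (m^n) stabilises, so m^n = (r m) m^n with r m in [M]. *)
Lemma max_nilpotent m : M m -> exists n, m ^+ n = 0.
Proof.
move=> Mm; have [n|n [r]] := @multiples_stable (fun n => m ^+ n).
  by rewrite exprS; apply: multiplesP.
rewrite exprS mulrA => mE; exists n; apply: (eq0_of_max_mul _ mE).
exact: idealM max_is_ideal Mm.
Qed.

(** A prime ideal contains all nilpotents, hence all of [M]. *)
Lemma prime_idealE P : is_prime_ideal P <-> P = M.
Proof.
rewrite is_primeP; split=> [[iP P1 PM]|->].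
  apply/seteqP; split; first exact: proper_sub_max.
  move=> m /max_nilpotent[n mn0].
  have : P (m ^+ n) by rewrite mn0; apply: ideal0.
  elim: n {mn0} => [|n IH]; first by rewrite expr0.
  by rewrite exprS => /PM[].
split; [exact: max_is_ideal|exact: max_not1|].
move=> a b Mab; have [|/unit_notin_max[c ca]] := pselect (M a); first by left.
by right; rewrite -[b]mul1r -ca -mulrA; apply: idealM => //; exact: max_is_ideal.
Qed.

Lemma PIS_adjE (u v : PIS R) :
  adj u v <-> u <> v /\ ideal_sum (val u) (val v) = M.
Proof. by rewrite /adj /= /pis_adj prime_idealE. Qed.

Lemma PIS_vertexP (u : PIS R) :
  [/\ is_ideal (val u), val u `<=` M & exists2 a, val u a & a <> 0].
Proof.
have [/is_properP[iu u1] u0] := set_mem (valP u).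
split=> //; first exact: proper_sub_max.
apply: contrapT => nu; apply: u0; apply/seteqP; split=> [a ua|_ ->].
  by apply: contrapT => a0; apply: nu; exists a.
exact: ideal0.
Qed.

Lemma PIS_vertex_exists I a : is_ideal I -> I `<=` M -> I a -> a <> 0 ->
  exists u : PIS R, val u = I.
Proof.
move=> iI IM Ia a0.
have vI : I \in pis_vertices R.
  apply: mem_set; split; last by move=> I0; rewrite I0 in Ia.
  by apply/is_properP; split=> // /IM /max_not1.
by exists (SigSub vI).
Qed.

(** * The space M / M^2: Nakayama and independent elements *)

Definition max_sq : set R := ideal_gen [set a * b | a in M & b in M].

Lemma max_sq_ideal : is_ideal max_sq. Proof. exact: ideal_gen_ideal. Qed.

Lemma max_sqM a b : M a -> M b -> max_sq (a * b).
Proof. by move=> Ma Mb; apply: sub_gen_smallest; exists a => //; exists b. Qed.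

(* [M] need not be known to be finitely generated or nilpotent: the descending
   chain condition on the principal ideals [(m_1 ... m_n)] forces some product
   [m_1 ... m_n] with [m_i] in [M] to vanish, which is all that is needed. *)
Lemma max_nakayama I :
  is_ideal I -> M `<=` ideal_sum I max_sq -> M `<=` I.
Proof.
move=> iI MI; apply: contrapT => nMI.
(* [Q p] says that p M is not contained in [I]. Starting from [Q 1], the property is kept forever
   under multiplication by suitable elements of [M]. *)
pose Q p := exists2 m, M m & ~ I (p * m).
have Qstep p : exists m, Q p -> M m /\ Q (p * m).
  apply: contrapT => np.
  have {}np m : ~ (Q p -> M m /\ Q (p * m)) by move=> ?; apply: np; exists m.
  have [m Mm Ipm] : Q p by apply: contrapT => nQ; apply: (np 0).
  (* The colon ideal (I : p). If no factor keeps [Q], it contains [I] and M^2, hence [M], against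
     [Q p]. *)
  pose J := [set t | I (p * t)].
  have iJ : is_ideal J.
    apply/is_idealP; split; first by rewrite /J /= mulr0; apply: ideal0.
    move=> r a b Ia Ib; rewrite /J /= mulrDr mulrCA.
    by apply: idealD => //; apply: idealM.
  suff : J m by [].
  have : ideal_sum I max_sq `<=` J.
    apply: ideal_sum_sub => //; first by move=> t It; apply: idealM.
    apply: smallest_sub => // _ [a Ma [b Mb <-]].
    apply: contrapT; rewrite /J /= mulrA => nI.
    by apply: (np a) => _; split=> //; exists b.
  by apply; apply: MI.
have [g gP] := choice Qstep.
pose q n := iter n (fun p => p * g p) 1.
have Qq n : Q (q n).
  elim: n => [|n /gP[]//].
  apply: contrapT => nQ; apply: nMI => m Mm; apply: contrapT => nIm.
  by apply: nQ; exists m; rewrite // mul1r.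
have [n|n [r qE]] := @multiples_stable q.
  by rewrite /q iterS mulrC; apply: multiplesP.
have [Mg _] := gP _ (Qq n).
have q0 : q n = 0.
  apply: (@eq0_of_max_mul (r * g (q n))); first exact: idealM max_is_ideal Mg.
  by rewrite [LHS]qE {1}/q iterS -/(q n); ring.
by have [m _] := Qq n; rewrite q0 mul0r; apply; apply: ideal0.
Qed.

(** An ideal that is no (a^n) lies in every (a^n): an element r a^n of it with r a unit would make
    it equal to (a^n). As [a] is nilpotent, such an ideal is zero, hence principal too. *)
Lemma principal_of_principal_max a :
  M = multiples a -> principal_ideal_ring R.
Proof.
move=> ME I iI; apply: contrapT => nI.
have {}nI b : I <> multiples b.
  by rewrite -ideal_gen1 => IE; apply: nI; exists b.
have In n : I `<=` multiples (a ^+ n).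
  elim: n => [|n IH] i Ii; first by exists i; rewrite // mulr1.
  have [r _ ri] := IH i Ii.
  have [Mr|/unit_notin_max[b br]] := pselect (M r).
    move: Mr ri; rewrite ME => -[s _ <-] <-.
    by rewrite -mulrA -exprS; apply: multiplesP.
  case: (nI (a ^+ n)); apply/seteqP; split=> //.
  apply: multiples_sub => //; rewrite -[_ ^+ n]mul1r -br -mulrA ri.
  exact: idealM.
have [|n an0] := @max_nilpotent a; first by rewrite ME; apply: multiples_self.
apply: (nI 0); apply/seteqP; split; first by have := In n; rewrite an0.
by apply: multiples_sub => //; apply: ideal0.
Qed.

(** For [P] between M^2 and [M], and [x], [y] in [M], this is linear independence of their classes
    in M / P over the residue field. *)
Definition indep_mod P x y : Prop :=
  forall a b, P (a * x + b * y) -> M a /\ M b.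

(** By Nakayama, (a) + M^2 is never [M]. With a = 0 this gives [x] outside M^2, then with a = x it
    gives [y] outside (x) + M^2. *)
Lemma exists_indep_max_sq : ~ (exists a, M = multiples a) ->
  exists x y, [/\ M x, M y & indep_mod max_sq x y].
Proof.
move=> nprin.
have sub_multiples a : M a -> ~ M `<=` multiples a.
  move=> Ma MP; apply: nprin; exists a; apply/seteqP; split=> //.
  exact: multiples_sub max_is_ideal Ma.
have pick a : M a -> exists2 b, M b & ~ ideal_sum (multiples a) max_sq b.
  move=> Ma; apply: contrapT => nb; apply: (sub_multiples a Ma).
  apply: max_nakayama; first exact: multiples_ideal.
  by move=> b Mb; apply: contrapT => nab; apply: nb; exists b.
have iM := max_is_ideal.
have [x Mx nx] := pick 0 (ideal0 iM).
have {}nx : ~ max_sq x.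
  by move=> sx; apply: nx; apply: sub_ideal_sumr sx; apply: multiples_ideal.
have [y My ny] := pick x Mx.
exists x, y; split=> // a b sab.
have Mb : M b.
  apply: contrapT => /unit_notin_max[c cb]; apply: ny.
  exists (- (c * a) * x); first exact: multiplesP.
  exists (c * (a * x + b * y)); first exact: idealM max_sq_ideal sab.
  by rewrite -[RHS]mul1r -cb; ring.
split=> //; apply: contrapT => /unit_notin_max[c ca]; apply: nx.
have -> : x = c * ((a * x + b * y) - b * y).
  by rewrite -[LHS]mul1r -ca; ring.
apply: (idealM _ max_sq_ideal); apply: (idealB max_sq_ideal sab).
exact: max_sqM.
Qed.

(* [P] is a subspace of codimension 2 in [M / M^2], with [x, y] spanning a
   complement; a maximal [P] meeting their span trivially exists by Zorn even
   without knowing that [M / M^2] is finite dimensional. *)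
Lemma exists_codim2 : ~ (exists a, M = multiples a) ->
  exists x y P, [/\ is_ideal P, max_sq `<=` P, indep_mod P x y &
    M = ideal_sum P (ideal_sum (multiples x) (multiples y))].
Proof.
move=> /exists_indep_max_sq[x [y [Mx My ind]]].
(* Combinations with a unit coefficient: an ideal avoids [S] exactly when [x] and [y] are
   independent modulo it. *)
pose S := [set z | exists a b, z = a * x + b * y /\ ~ (M a /\ M b)].
have sS : max_sq `<=` ~` S.
  by move=> z sz [a [b [zE nab]]]; apply: nab; apply: ind; rewrite -zE.
have [P [iP sP PS maxP]] := Zorn_ideal max_sq_ideal sS.
have iM := max_is_ideal.
have [ix iy] := (multiples_ideal x, multiples_ideal y).
have ixy := ideal_sum_ideal ix iy.
exists x, y, P.
have indP : indep_mod P x y.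
  by move=> a b Pab; apply: contrapT => nab; apply: (PS _ Pab); exists a, b.
split=> //; apply/seteqP; split; last first.
  apply: ideal_sum_sub => //.
    apply: proper_sub_max => // P1; apply: max_not1.
    have Px : P (1 * x + 0 * y).
      by rewrite mul1r mul0r addr0 -[x]mulr1; apply: idealM.
    by have [] := indP _ _ Px.
  by apply: ideal_sum_sub => //; apply: multiples_sub.
move=> z Mz; have [Pz|nPz] := pselect (P z).
  exact: (sub_ideal_suml ixy Pz).
have iz := multiples_ideal z; have iPz := ideal_sum_ideal iP iz.
(* By maximality of [P], the ideal P + (z) meets [S] in some w = p + r z. Here [r] is a unit, since
   otherwise r z is in M^2 and [w] in [P]; so the equation can be solved for [z]. *)
have [w [Pw [a [b [wE nab]]]]] : exists w, ideal_sum P (multiples z) w /\ S w.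
  apply: contrapT => nS; apply: nPz.
  rewrite -(maxP (ideal_sum P (multiples z))) //.
  - exact: (sub_ideal_sumr iP (multiples_self z)).
  - exact: sub_ideal_suml.
  - by move=> w Pw Sw; apply: nS; exists w.
move: Pw => [p Pp [_ [r _ <-]] pE].
have nMr : ~ M r.
  move=> Mr; apply: nab; apply: indP; rewrite -wE -pE.
  by apply: idealD => //; apply: sP; apply: max_sqM.
have [c cr] := unit_notin_max nMr.
exists (- c * p); first exact: idealM.
exists (c * (a * x + b * y)); last first.
  by rewrite -wE -pE -[RHS]mul1r -cr; ring.
apply: idealM => //; exists (a * x); first exact: multiplesP.
by exists (b * y) => //; exact: multiplesP.
Qed.

(* If [P] is nonzero, it is the centre of a claw in the complement of [PIS R],
   with leaves [P + (x)], [P + (y)] and [P + (x + y)]. *)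
Lemma codim2_coclaw x y P :
  is_co_line_graph (PIS R) -> is_ideal P -> indep_mod P x y ->
  M = ideal_sum P (ideal_sum (multiples x) (multiples y)) ->
  P `<=` [set 0].
Proof.
move=> coL iP ind ME p Pp; apply: contrapT => p0.
have iM := max_is_ideal.
have [ix iy] := (multiples_ideal x, multiples_ideal y).
have ixy := ideal_sum_ideal ix iy.
have PM : P `<=` M by rewrite ME; apply: sub_ideal_suml.
have Mxy : ideal_sum (multiples x) (multiples y) `<=` M.
  by rewrite [X in _ `<=` X]ME; apply: sub_ideal_sumr.
have Mx : M x by apply: Mxy; apply: sub_ideal_suml iy _ (multiples_self x).
have My : M y by apply: Mxy; apply: sub_ideal_sumr ix _ (multiples_self y).
have notP a b : ~ (M a /\ M b) -> ~ P (a * x + b * y).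
  by move=> nab /ind.
pose A w := ideal_sum P (multiples w).
have iA w : is_ideal (A w).
  by apply: ideal_sum_ideal => //; apply: multiples_ideal.
have PA w : P `<=` A w by apply: sub_ideal_suml; apply: multiples_ideal.
have Aw w : A w w by apply: sub_ideal_sumr iP _ (multiples_self w).
have AM w : M w -> A w `<=` M.
  by move=> Mw; apply: ideal_sum_sub => //; apply: multiples_sub.
have [c cE] : exists u : PIS R, val u = P by apply: PIS_vertex_exists Pp p0.
have leaf w : M w -> exists u : PIS R, val u = A w.
  by move=> Mw; apply: (@PIS_vertex_exists _ p) => //; [exact: AM|exact: PA].
(* As [A w] contains [P], their sum lies in [A w], which misses [z]. *)
have far w (u : PIS R) z : val u = A w -> M z -> ~ A w z -> ~ adj c u.
  move=> uE Mz nz /PIS_adjE[_]; rewrite cE uE => E.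
  by apply: nz; move: Mz; rewrite -E; apply: ideal_sum_sub => //; exact: PA.
(* The sum of two leaves contains [P], so it is [M] once it contains [x] and [y]. *)
have near w w' (u v : PIS R) : val u = A w -> val v = A w' -> M w -> M w' ->
    ~ A w w' -> ideal_sum (A w) (A w') x -> ideal_sum (A w) (A w') y -> adj u v.
  move=> uE vE Mw Mw' nw sx sy; apply/PIS_adjE; split.
    by move=> uv; apply: nw; rewrite -uE uv vE; exact: Aw.
  rewrite uE vE; apply/seteqP; split.
    by apply: ideal_sum_sub => //; apply: AM.
  have iww := ideal_sum_ideal (iA w) (iA w').
  rewrite ME; apply: ideal_sum_sub => //.
    by move=> q Pq; apply: (sub_ideal_suml (iA w')); exact: PA.
  by apply: ideal_sum_sub => //; apply: multiples_sub.
have neq w (u : PIS R) : val u = A w -> ~ P w -> c <> u.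
  by move=> uE nPw cu; apply: nPw; rewrite -cE cu uE; exact: Aw.
have Mxpy : M (x + y) by apply: idealD.
have nM0 a b : a = 1 \/ b = 1 -> ~ (M a /\ M b).
  by move=> [] -> [Ma Mb]; apply: max_not1.
have nxP : ~ P x.
  by have := @notP 1 0; rewrite mul1r mul0r addr0; apply; apply: nM0; left.
have nyP : ~ P y.
  by have := @notP 0 1; rewrite mul1r mul0r add0r; apply; apply: nM0; right.
have nxyP : ~ P (x + y).
  by have := @notP 1 1; rewrite !mul1r; apply; apply: nM0; left.
have nAxy : ~ A x y.
  move=> [q Pq [_ [r _ <-]] E].
  apply: (@notP (- r) 1); first by apply: nM0; right.
  by rewrite -E; have -> : - r * x + 1 * (q + r * x) = q by ring.
have nAyx : ~ A y x.
  move=> [q Pq [_ [r _ <-]] E].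
  apply: (@notP 1 (- r)); first by apply: nM0; left.
  by rewrite -E; have -> : 1 * (q + r * y) + - r * y = q by ring.
have nAxyx : ~ A (x + y) x.
  move=> [q Pq [_ [r _ <-]] E].
  (* If x = q + r (x + y), then (1 - r) x - r y is in [P]; the two coefficients differ by 1, so they
     are not both in [M]. *)
  apply: (@notP (1 - r) (- r)).
    move=> [M1r MNr]; apply: max_not1.
    have -> : 1 = (1 - r) - (- r) by ring.
    exact: idealB.
  have -> : (1 - r) * x + - r * y = x - r * (x + y) by ring.
  by rewrite -{1}E addrK.
have nAx_xy : ~ A x (x + y).
  move=> h; apply: nAxy; have -> : y = (x + y) - x by ring.
  exact: idealB.
have nAy_xy : ~ A y (x + y).
  move=> h; apply: nAyx; have -> : x = (x + y) - y by ring.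
  exact: idealB.
have [u1 e1] := leaf x Mx; have [u2 e2] := leaf y My.
have [u3 e3] := leaf _ Mxpy.
have sum_l w w' z : A w z -> ideal_sum (A w) (A w') z by apply: sub_ideal_suml.
have sum_r w w' z : A w' z -> ideal_sum (A w) (A w') z by apply: sub_ideal_sumr.
apply: (co_line_no_coclaw coL
  (neq _ _ e1 nxP) (neq _ _ e2 nyP) (neq _ _ e3 nxyP)).
- exact: far e1 My nAxy.
- exact: far e2 Mx nAyx.
- exact: far e3 Mx nAxyx.
- apply: near e1 e2 _ _ _ _ _ => //; first by apply: sum_l; exact: Aw.
  by apply: sum_r; exact: Aw.
- apply: near e1 e3 _ _ _ _ _ => //; first by apply: sum_l; exact: Aw.
  set S := ideal_sum _ _; have -> : y = (x + y) - x by ring.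
  apply: idealB; first exact: ideal_sum_ideal.
    by apply: sum_r; exact: Aw.
  by apply: sum_l; exact: Aw.
- apply: near e2 e3 _ _ _ _ _ => //; last by apply: sum_l; exact: Aw.
  set S := ideal_sum _ _; have -> : x = (x + y) - y by ring.
  apply: idealB; first exact: ideal_sum_ideal.
    by apply: sum_r; exact: Aw.
  by apply: sum_l; exact: Aw.
Qed.

(** * Sufficiency of the two conditions *)

Lemma co_line_of_principal a : M = multiples a -> is_co_line_graph (PIS R).
Proof.
move=> ME; have iM := max_is_ideal.
have Ma : M a by rewrite ME; apply: multiples_self.
(* The colour is a truth value: the vertex [M] has one colour and all other vertices share the
   other. *)
apply: (@complete_multipartite_co_line _ Prop (fun u : PIS R => val u = M)).
move=> u v; rewrite PIS_adjE.
have [iu uM [m um m0]] := PIS_vertexP u; have [iv vM _] := PIS_vertexP v.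
have maxE I r : is_ideal I -> I `<=` M -> ~ M r -> I (r * a) -> I = M.
  move=> iI IM /unit_notin_max[b br] Ia; apply/seteqP; split=> //.
  rewrite ME; apply: multiples_sub => //.
  by rewrite -[a]mul1r -br -mulrA; apply: idealM.
split=> [[uv sM] uvM|uvM].
  have [uE|nuE] := pselect (val u = M).
    by apply: uv; apply: val_inj; move: (uE); rewrite uvM uE => ->.
  have nvE : val v <> M by rewrite -uvM.
  have : ideal_sum (val u) (val v) a by rewrite sM.
  move=> [b ub [c vc abc]].
  have : M b by apply: uM. have : M c by apply: vM.
  rewrite {1 2}ME => -[s _ sE] [r _ rE].
  (* A unit coefficient would put [a] in one of the two ideals and make it [M]. So both are in [M],
     and a = (r + s) a gives a = 0, leaving no nonzero element for a vertex. *)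
  have Mr : M r.
    by apply: contrapT => nMr; apply: nuE; apply: maxE nMr _ => //; rewrite rE.
  have Ms : M s.
    by apply: contrapT => nMs; apply: nvE; apply: maxE nMs _ => //; rewrite sE.
  have a0 : a = 0.
    apply: (@eq0_of_max_mul (r + s)); first exact: idealD.
    by rewrite mulrDl rE sE abc.
  by apply: m0; have := uM _ um; rewrite ME a0 => -[t _ <-]; rewrite mulr0.
split; first by move=> uv; apply: uvM; rewrite uv.
have [uE|nuE] := pselect (val u = M).
  rewrite uE; apply/seteqP; split; first exact: ideal_sum_sub.
  exact: sub_ideal_suml.
have [vE|nvE] := pselect (val v = M).
  rewrite vE; apply/seteqP; split; first exact: ideal_sum_sub.
  exact: sub_ideal_sumr.
by case: uvM; apply/propext; split.
Qed.

(** Since M^2 = 0, [M] is a vector space over the residue field, spanned by [x] and [y]. A nonzero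
    [v] in [J] and a [u] in [I] outside [J] are independent, so they span it. *)
Lemma square_zero_sum_eq_max x y I J :
  M = ideal_gen [set x; y] -> (forall a b, M a -> M b -> a * b = 0) ->
  is_ideal I -> is_ideal J -> I `<=` M -> J `<=` M ->
  (exists2 b, J b & b <> 0) -> ~ I `<=` J -> ideal_sum I J = M.
Proof.
rewrite ideal_gen2 => ME sq0 iI iJ IM JM [v Jv v0] nIJ.
have iM := max_is_ideal; have [ix iy] := (multiples_ideal x, multiples_ideal y).
have Mx : M x.
  by rewrite ME; apply: sub_ideal_suml => //; apply: multiples_self.
have My : M y.
  by rewrite ME; apply: sub_ideal_sumr => //; apply: multiples_self.
have [u Iu nJu] : exists2 u, I u & ~ J u.
  apply: contrapT => nu; apply: nIJ => u Iu; apply: contrapT => nJu.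
  by apply: nu; exists u.
have : M u by apply: IM. have : M v by apply: JM.
rewrite ME => -[_ [c _ <-] [_ [d _ <-] vE]] [_ [a _ <-] [_ [b _ <-] uE]].
apply/seteqP; split; first by rewrite -ME; apply: ideal_sum_sub.
have iIJ := ideal_sum_ideal iI iJ.
have Su : ideal_sum I J u by apply: sub_ideal_suml.
have Sv : ideal_sum I J v by apply: sub_ideal_sumr.
have [Mdet|/unit_notin_max[e eE]] := pselect (M (a * d - b * c)); last first.
  (* Cramer's rule: with unit determinant, [x] and [y] are combinations of [u] and [v]. *)
  apply: ideal_sum_sub => //; apply: multiples_sub => //.
    have -> : x = e * (d * u - b * v).
      by rewrite -uE -vE -[LHS]mul1r -eE; ring.
    by apply: idealM => //; apply: idealB => //; apply: idealM.
  have -> : y = e * (a * v - c * u).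
    by rewrite -uE -vE -[LHS]mul1r -eE; ring.
  by apply: idealM => //; apply: idealB => //; apply: idealM.
(* A determinant in [M] kills [x] and [y]. As [v] is nonzero, [c] or [d] is a unit, and [u] becomes
   a multiple of [v]. *)
case: nJu.
have [Mc|/unit_notin_max[e ec]] := pselect (M c).
  have [Md|/unit_notin_max[e ed]] := pselect (M d).
    by case: v0; rewrite -vE !sq0 // addr0.
  have -> : u = e * b * v + e * ((a * d - b * c) * x).
    by rewrite -[LHS]mul1r -ed -uE -vE; ring.
  by rewrite [_ * x]sq0 // mulr0 addr0; apply: idealM.
have -> : u = e * a * v - e * ((a * d - b * c) * y).
  by rewrite -[LHS]mul1r -ec -uE -vE; ring.
by rewrite [_ * y]sq0 // mulr0 subr0; apply: idealM.
Qed.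

Lemma co_line_of_square_zero x y :
  M = ideal_gen [set x; y] -> x ^+ 2 = 0 -> y ^+ 2 = 0 -> x * y = 0 ->
  is_co_line_graph (PIS R).
Proof.
move=> ME x2 y2 xy0.
have sq0 a b : M a -> M b -> a * b = 0.
  rewrite ME ideal_gen2.
  move=> [_ [r _ <-] [_ [s _ <-] <-]] [_ [r' _ <-] [_ [s' _ <-] <-]].
  have -> : (r * x + s * y) * (r' * x + s' * y) =
    r * r' * x ^+ 2 + s * s' * y ^+ 2 + (r * s' + s * r') * (x * y) by ring.
  by rewrite x2 y2 xy0 !mulr0 !addr0.
(* Every vertex is its own colour, because the graph is complete: of two distinct ideals, one is not
   contained in the other. *)
apply: (@complete_multipartite_co_line _ _ (@id (PIS R))) => u v.
rewrite PIS_adjE; split=> [[]//|uv]; split=> //.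
have [iu uM u0] := PIS_vertexP u; have [iv vM v0] := PIS_vertexP v.
have [uv'|nuv] := pselect (val u `<=` val v); last first.
  exact: square_zero_sum_eq_max ME sq0 iu iv uM vM v0 nuv.
rewrite ideal_sumC; apply: square_zero_sum_eq_max ME sq0 iv iu vM uM u0 _.
by move=> vu; apply: uv; apply: val_inj; apply/seteqP.
Qed.

End ArtinianLocal.

Theorem theorem3p1 (R : comNzRingType) (M : set R) :
  artinian R -> local_ring_with M ->
  (is_co_line_graph (PIS R) <->
     principal_ideal_ring R \/
     exists x y : R, [/\ M = ideal_gen [set x; y],
                         x ^+ 2 = 0, y ^+ 2 = 0 & x * y = 0]).
Proof.
move=> artR locM; have iM := max_is_ideal locM; split=> [coL|[prin|]].
- have [[a ME]|nprin] := pselect (exists a, M = multiples a).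
    by left; apply: principal_of_principal_max ME.
  right; have [x [y [P [iP sP ind ME]]]] := exists_codim2 artR locM nprin.
  (* Once [P] is zero, [M] is generated by [x] and [y], and M^2 inside [P] gives the three
     relations. *)
  have P0 := codim2_coclaw artR locM coL iP ind ME.
  have ixy := ideal_sum_ideal (multiples_ideal x) (multiples_ideal y).
  have {}ME : M = ideal_gen [set x; y].
    rewrite ideal_gen2 ME; apply/seteqP; split; last exact: sub_ideal_sumr.
    by apply: ideal_sum_sub => // p /P0 ->; apply: ideal0.
  have Mx : M x by rewrite ME; apply: sub_gen_smallest; left.
  have My : M y by rewrite ME; apply: sub_gen_smallest; right.
  by exists x, y; split; rewrite ?expr2 //; apply: P0; apply: sP; apply: max_sqM.
- have [a ME] := prin M iM; rewrite ideal_gen1 in ME.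
  exact: co_line_of_principal ME.
- by move=> [x [y [ME x2 y2 xy0]]]; apply: co_line_of_square_zero ME x2 y2 xy0.
Qed.
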